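(* Let the collision term be $\mathcal C(f)=-\phi_0f+\phi_0\frac12\int_{-1}^1f\,d\mu+3\mu\phi_1\frac12\int_{-1}^1f\mu\,d\mu$, with $\tilde\chi\ne0$, $\tilde\chi+\phi_0\ne0$ and $\tilde\chi+\phi_0-\phi_1\neq0$. Let $f=\sum_{i\ge0}\varepsilon^if_i$ be the Hilbert expansion and $\beta=\frac12\int_{-1}^1f\,d\mu$. Then (without assuming Enskog's postulate or the strong Chapman--Enskog hypothesis) the diffusion-reaction-type equation $$\frac{d\beta}{c\,dt}+\frac13\frac{d\ln\rho}{c\,dt}\,\omega\frac{\partial\beta}{\partial\omega}-\frac1{r^2}\frac{\partial}{\partial r}\Big(r^2\frac\lambda3\frac{\partial\beta}{\partial r}\Big)=j-\tilde\chi\beta$$ is an approximation of the angular mean of Boltzmann's equation $\mathcal D(f)=\varepsilon^{-1}\big(\bar j+\bar{\mathcal J}(f)\big)$ of order $\mathcal O(\varepsilon^2)$ up to $\mathcal D^+\big(\mathcal D^+(\cdot)\big)$ terms.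
   Context: Variables: time $t$, radius $r>0$, cosine of the propagation angle $\mu\in[-1,1]$, energy $\omega>0$; $f=f(t,r,\mu,\omega)$. The constant $c>0$ is the speed of light; $\rho=\rho(t,r)>0$ and $v=v(t,r)$ are given functions (density and radial velocity of the background matter), and $\frac{d}{dt}:=\frac{\partial}{\partial t}+v\frac{\partial}{\partial r}$. The linear operator $\mathcal D=\mathcal D^++\mathcal D^-$ is given by $$\mathcal D^+(f)=\frac{df}{c\,dt}+\mu\Big(\frac{d\ln\rho}{c\,dt}+\frac{3v}{cr}\Big)(1-\mu^2)\frac{\partial f}{\partial\mu}+\Big[\mu^2\Big(\frac{d\ln\rho}{c\,dt}+\frac{3v}{cr}\Big)-\frac v{cr}\Big]\omega\frac{\partial f}{\partial\omega},$$ $$\mathcal D^-(f)=\mu\frac{\partial f}{\partial r}+\frac1r(1-\mu^2)\frac{\partial f}{\partial\mu}.$$ The functions $j\ge0$ (emissivity), $\chi\geq 0$ (absorptivity), $\tilde\chi=j+\chi$, $\phi_0,\phi_1$ depend on $(t,r,\omega)$ but not on $\mu$. Put $\mathcal J(f)=-\tilde\chi f+\mathcal C(f)$ and $\lambda=\frac1{\tilde\chi+\phi_0-\phi_1}$. Here $\varepsilon>0$ is a small parameter, $\bar j=\varepsilon j$, $\bar{\tilde\chi}=\varepsilon\tilde\chi$, $\bar\phi_0=\varepsilon\phi_0$, $\bar\phi_1=\varepsilon\phi_1$, $\bar{\mathcal J}=\varepsilon\mathcal J$, and the barred quantities are independent of $\varepsilon$ (so $j,\tilde\chi$ are of order $\varepsilon^{-1}$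 and $\lambda$ is of order $\varepsilon$). Hilbert expansion: $f=\sum_{i\ge0}\varepsilon^if_i$, $\mathcal D(f)=\sum_{i\ge0}\varepsilon^i\mathcal D(f_i)$, and the $f_i$ solve the hierarchy $0=j+\mathcal J(f_0)$, $\mathcal D(f_{i-1})=\bar{\mathcal J}(f_i)$, $i=1,2,\dots$. Meaning of the conclusion: the angular mean of Boltzmann's equation is $\frac12\int_{-1}^1\mathcal D(f)\,d\mu=j-\tilde\chi\beta$. The conclusion states that its left-hand side equals the left-hand side of the displayed equation, plus $N$, plus $\mathcal O(\varepsilon^2)$, where $N$ consists of $\mathcal D^+(\mathcal D^+(\cdot))$ terms, i.e. terms in which $\mathcal D^+$ is applied twice: a sum of terms of the form $\frac12\int_{-1}^1\mathcal D^+\big(a\,\mathcal D^+(f_0)\big)d\mu$ or $\frac12\int_{-1}^1\mathcal D^+\big(a\,\frac12\int_{-1}^1\mathcal D^+(f_0)\,d\mu'\big)d\mu$ with coefficients $a$ built from $\tilde\chi,\phi_0$ (such as $\frac{-1}{\tilde\chi+\phi_0}$ and $\frac{-1}{\tilde\chi+\phi_0}\frac{\phi_0}{\tilde\chi}$, which occur when the decomposition $\mathcal D=\mathcal D^++\mathcal D^-$ is inserted in the formula $\varepsilon f_1=\frac{-1}{\tilde\chi+\phi_0}\big(\mathcal D(f_0)+\frac{\phi_0}{\tilde\chi}\frac12\int_{-1}^1\mathcal D(f_0)d\mu+3\mu\phi_1\lambda\frac12\int_{-1}^1\mathcal D(f_0)\mu\,d\mu\big)$ and in $\frac12\int_{-1}^1\mathcal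 D(\varepsilon f_1)\,d\mu$). All series are formal; series, integrals and partial derivatives are assumed to be interchangeable; $\mathcal O(\varepsilon^k)$ denotes, in the formal sense, the neglected part starting with order $\varepsilon^k$ of a formal series in $\varepsilon$. *)

(* Defs.v *)
From Stdlib Require Import Reals ZArith.
From Coquelicot Require Import Coquelicot.
Open Scope R_scope.

(* Arguments are always in the order time t, radius r, angle cosine mu,
   energy om; the type of a function records what it may depend on. *)
Definition bgfun := R -> R -> R.                 (* t r *)
Definition radfun := R -> R -> R -> R.           (* t r om *)
Definition phasefun := R -> R -> R -> R -> R.    (* t r mu om *)

Definition lift (a : radfun) : phasefun := fun t r _ om => a t r om.
Definition lift_bg (a : bgfun) : phasefun := fun t r _ _ => a t r.

Definition rad_dom (T : R -> Prop) (t r om : R) : Prop :=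
  T t /\ 0 < r /\ 0 < om.

Definition phase_dom (T : R -> Prop) (t r mu om : R) : Prop :=
  rad_dom T t r om /\ -1 <= mu <= 1.

Definition pd_t (f : phasefun) : phasefun :=
  fun t r mu om => Derive (fun s => f s r mu om) t.
Definition pd_r (f : phasefun) : phasefun :=
  fun t r mu om => Derive (fun s => f t s mu om) r.
Definition pd_mu (f : phasefun) : phasefun :=
  fun t r mu om => Derive (fun s => f t r s om) mu.
Definition pd_om (f : phasefun) : phasefun :=
  fun t r mu om => Derive (fun s => f t r mu s) om.

(* C^k regularity at the points of the phase domain.  Continuity and
   derivatives are two-sided, also at mu = -1 and mu = 1: there f stands for a
   C^k extension slightly beyond the interval [-1,1]. *)
Definition cont_on (T : R -> Prop) (f : phasefun) : Prop :=
  forall t r mu om, phase_dom T t r mu om ->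
    continuous
      (fun x : R * R * R * R =>
         f (fst (fst (fst x))) (snd (fst (fst x))) (snd (fst x)) (snd x))
      (t, r, mu, om).

Definition partially_derivable_on (T : R -> Prop) (f : phasefun) : Prop :=
  forall t r mu om, phase_dom T t r mu om ->
    ex_derive (fun s => f s r mu om) t /\
    ex_derive (fun s => f t s mu om) r /\
    ex_derive (fun s => f t r s om) mu /\
    ex_derive (fun s => f t r mu s) om.

Fixpoint class_C (k : nat) (T : R -> Prop) (f : phasefun) : Prop :=
  cont_on T f /\
  match k with
  | O => True
  | S k' => partially_derivable_on T f /\
            class_C k' T (pd_t f) /\ class_C k' T (pd_r f) /\
            class_C k' T (pd_mu f) /\ class_C k' T (pd_om f)
  end.

Definition mean (f : phasefun) : radfun :=
  fun t r om => / 2 * RInt (fun mu => f t r mu om) (-1) 1.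

Definition mean_mu (f : phasefun) : radfun :=
  fun t r om => / 2 * RInt (fun mu => f t r mu om * mu) (-1) 1.

(* d/(c dt) of ln rho, where d/dt = partial_t + v partial_r *)
Definition dlnrho (c : R) (rho v : bgfun) : bgfun := fun t r =>
  (Derive (fun s => ln (rho s r)) t
   + v t r * Derive (fun s => ln (rho t s)) r) / c.

Definition Dplus (c : R) (rho v : bgfun) (f : phasefun) : phasefun :=
  fun t r mu om =>
    (pd_t f t r mu om + v t r * pd_r f t r mu om) / c
    + mu * (dlnrho c rho v t r + 3 * v t r / (c * r)) * (1 - mu ^ 2)
      * pd_mu f t r mu om
    + (mu ^ 2 * (dlnrho c rho v t r + 3 * v t r / (c * r)) - v t r / (c * r))
      * om * pd_om f t r mu om.

Definition Dminus (f : phasefun) : phasefun := fun t r mu om =>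
  mu * pd_r f t r mu om + / r * (1 - mu ^ 2) * pd_mu f t r mu om.

Definition Dop (c : R) (rho v : bgfun) (f : phasefun) : phasefun :=
  fun t r mu om => Dplus c rho v f t r mu om + Dminus f t r mu om.

Definition Cop (phi0 phi1 : radfun) (f : phasefun) : phasefun :=
  fun t r mu om =>
    - phi0 t r om * f t r mu om
    + phi0 t r om * mean f t r om
    + 3 * mu * phi1 t r om * mean_mu f t r om.

Definition Jop (tchi phi0 phi1 : radfun) (f : phasefun) : phasefun :=
  fun t r mu om => - tchi t r om * f t r mu om + Cop phi0 phi1 f t r mu om.

Definition lambda (tchi phi0 phi1 : radfun) : radfun :=
  fun t r om => / (tchi t r om + phi0 t r om - phi1 t r om).

Definition rad_add (a b : radfun) : radfun :=
  fun t r om => a t r om + b t r om.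

(* The hierarchy in terms of the eps-independent (barred) coefficients; the
   equation 0 = j + J(f_0) has been multiplied by eps. *)
Definition hilbert_hierarchy (T : R -> Prop) (c : R) (rho v : bgfun)
    (jb tchib phi0b phi1b : radfun) (f : nat -> phasefun) : Prop :=
  (forall t r mu om, phase_dom T t r mu om ->
     0 = jb t r om + Jop tchib phi0b phi1b (f O) t r mu om) /\
  (forall i t r mu om, phase_dom T t r mu om ->
     Dop c rho v (f i) t r mu om
     = Jop tchib phi0b phi1b (f (S i)) t r mu om).

(* Formal Laurent series in eps: s n is the coefficient of eps^n. *)
Definition rad_series := Z -> radfun.
Definition phase_series := Z -> phasefun.

Definition series0 : rad_series := fun _ _ _ _ => 0.

Definition series_add (s s' : rad_series) : rad_series :=
  fun n t r om => s n t r om + s' n t r om.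

Definition series_sub (s s' : rad_series) : rad_series :=
  fun n t r om => s n t r om - s' n t r om.

(* the series eps^k a *)
Definition monomial (k : Z) (a : radfun) : rad_series :=
  fun n t r om => if Z.eqb n k then a t r om else 0.

(* the product (eps^k a) s *)
Definition mono_mul (k : Z) (a : radfun) (s : rad_series) : rad_series :=
  fun n t r om => a t r om * s (n - k)%Z t r om.

(* sum over i >= 0 of eps^i f_i *)
Definition expansion (f : nat -> phasefun) : phase_series :=
  fun n => if (n <? 0)%Z then (fun _ _ _ _ => 0) else f (Z.to_nat n).

Definition mean_series (F : phase_series) : rad_series := fun n => mean (F n).

Definition Dop_series (c : R) (rho v : bgfun) (F : phase_series)
  : phase_series := fun n => Dop c rho v (F n).

Definition series_eq (T : R -> Prop) (s s' : rad_series) : Prop :=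
  forall n t r om, rad_dom T t r om -> s n t r om = s' n t r om.

(* s = s' + O(eps^k) *)
Definition series_eq_upto (T : R -> Prop) (k : Z) (s s' : rad_series) : Prop :=
  forall n t r om, (n < k)%Z -> rad_dom T t r om -> s n t r om = s' n t r om.

(* j - tchi beta, with j = eps^-1 jb and tchi = eps^-1 tchib *)
Definition reaction_rhs (jb tchib : radfun) (beta : rad_series) : rad_series :=
  series_sub (monomial (-1) jb) (mono_mul (-1) tchib beta).

Definition rad_pd_r (s : rad_series) : rad_series :=
  fun n t r om => Derive (fun x => s n t x om) r.

(* Left-hand side of the diffusion-reaction equation, with lambda = eps lamb. *)
Definition diffusion_lhs (c : R) (rho v : bgfun) (lamb : radfun)
    (beta : rad_series) : rad_series := fun n t r om =>
  (Derive (fun s => beta n s r om) t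
   + v t r * Derive (fun s => beta n t s om) r) / c
  + / 3 * dlnrho c rho v t r * om * Derive (fun s => beta n t r s) om
  - / r ^ 2
    * Derive (fun s => s ^ 2 * (mono_mul 1 lamb (rad_pd_r beta) n t s om / 3)) r.

(* coeff_built T tchib phi0b k a: the function eps^k a is a rational expression
   with rational constants in tchi = eps^-1 tchib and phi0 = eps^-1 phi0b, all
   subexpressions being homogeneous in eps and all denominators nonzero. *)
Inductive coeff_built (T : R -> Prop) (tchib phi0b : radfun)
  : Z -> radfun -> Prop :=
| built_tchi : coeff_built T tchib phi0b (-1) tchib
| built_phi0 : coeff_built T tchib phi0b (-1) phi0b
| built_one : coeff_built T tchib phi0b 0 (fun _ _ _ => 1)
| built_opp : forall k a, coeff_built T tchib phi0b k a ->
    coeff_built T tchib phi0b k (fun t r om => - a t r om)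
| built_add : forall k a b,
    coeff_built T tchib phi0b k a -> coeff_built T tchib phi0b k b ->
    coeff_built T tchib phi0b k (fun t r om => a t r om + b t r om)
| built_mul : forall k l a b,
    coeff_built T tchib phi0b k a -> coeff_built T tchib phi0b l b ->
    coeff_built T tchib phi0b (k + l) (fun t r om => a t r om * b t r om)
| built_inv : forall k a, coeff_built T tchib phi0b k a ->
    (forall t r om, rad_dom T t r om -> a t r om <> 0) ->
    coeff_built T tchib phi0b (- k) (fun t r om => / a t r om).

(* the angular mean of D^+ (a g) *)
Definition mean_Dplus_mul (c : R) (rho v : bgfun) (a : radfun) (g : phasefun)
  : radfun :=
  mean (Dplus c rho v (fun t r mu om => a t r om * g t r mu om)).

(* Finite sums of D^+(D^+(.)) terms applied to f0. *)
Inductive DplusDplus_terms (T : R -> Prop) (c : R) (rho v : bgfun)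
    (tchib phi0b : radfun) (f0 : phasefun) : rad_series -> Prop :=
| DD_nil : DplusDplus_terms T c rho v tchib phi0b f0 series0
| DD_direct : forall k a N,
    coeff_built T tchib phi0b k a ->
    DplusDplus_terms T c rho v tchib phi0b f0 N ->
    DplusDplus_terms T c rho v tchib phi0b f0
      (series_add
         (monomial k (mean_Dplus_mul c rho v a (Dplus c rho v f0))) N)
| DD_mean : forall k a N,
    coeff_built T tchib phi0b k a ->
    DplusDplus_terms T c rho v tchib phi0b f0 N ->
    DplusDplus_terms T c rho v tchib phi0b f0
      (series_add
         (monomial k
            (mean_Dplus_mul c rho v a (lift (mean (Dplus c rho v f0))))) N).

(* Main.v *)
(** Every Hilbert coefficient that matters is a quadratic polynomial in mu:
    inverting the collision operator gives f_0 isotropic (the first moment of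
    f_0 vanishes because tchi + phi0 - phi1 <> 0), so D(f_0) is quadratic in
    mu, hence so is f_1 = P + mu Q + mu^2 S.  Consequently all angular means
    are computed exactly, and P, Q, S inherit the regularity of f_1 because
    they are combinations of its values at mu = -1, 0, 1.
    D^+ preserves parity in mu and D^- reverses it, so the odd part mu Q enters
    the mean of D(f_1) only through D^-, and Q = - lambda d_r f_0 produces the
    diffusion term.  The even part of f_1 minus its mean is
    - D^+(f_0) / (tchi + phi0) + mean (D^+ f_0) / (tchi + phi0), so the rest
    consists of D^+(D^+(.)) terms. *)

Require Import Defs.
From Stdlib Require Import Reals ZArith Lra Lia.
From Coquelicot Require Import Coquelicot.
Open Scope R_scope.

(** * Agreement and differentiability on the domain *)

Definition agree (T : R -> Prop) (f g : phasefun) : Prop :=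
  forall t r mu om, phase_dom T t r mu om -> f t r mu om = g t r mu om.

Definition rad_agree (T : R -> Prop) (p q : radfun) : Prop :=
  forall t r om, rad_dom T t r om -> p t r om = q t r om.

Definition rad_derivable (T : R -> Prop) (p : radfun) : Prop :=
  forall t r om, rad_dom T t r om ->
    ex_derive (fun s => p s r om) t /\
    ex_derive (fun s => p t s om) r /\
    ex_derive (fun s => p t r s) om.

Definition quad (p q s : radfun) : phasefun :=
  fun t r mu om => p t r om + mu * q t r om + mu ^ 2 * s t r om.

Definition rad0 : radfun := fun _ _ _ => 0.

Lemma locally_rad_dom_t (T : R -> Prop) t r om :
  open T -> rad_dom T t r om -> locally t (fun s => rad_dom T s r om).
Proof.
  intros HT [Ht Hro]. apply (filter_imp T); [|now apply HT].
  intros s Hs. now split.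
Qed.

Lemma locally_rad_dom_r (T : R -> Prop) t r om :
  rad_dom T t r om -> locally r (fun s => rad_dom T t s om).
Proof.
  intros (Ht & Hr & Ho). apply (filter_imp (fun s => 0 < s)).
  - intros s Hs. now repeat split.
  - now apply (open_gt 0).
Qed.

Lemma locally_rad_dom_om (T : R -> Prop) t r om :
  rad_dom T t r om -> locally om (fun s => rad_dom T t r s).
Proof.
  intros (Ht & Hr & Ho). apply (filter_imp (fun s => 0 < s)).
  - intros s Hs. now repeat split.
  - now apply (open_gt 0).
Qed.

(** The domain is open along the t, r and om axes, so agreement on it is agreement near each point
    along each axis and passes to the derivatives. *)
Lemma rad_agree_Derive (T : R -> Prop) p q t r om :
  open T -> rad_agree T p q -> rad_dom T t r om ->
  Derive (fun s => p s r om) t = Derive (fun s => q s r om) t /\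
  Derive (fun s => p t s om) r = Derive (fun s => q t s om) r /\
  Derive (fun s => p t r s) om = Derive (fun s => q t r s) om.
Proof.
  intros HT Hpq Hd. repeat split; apply Derive_ext_loc.
  - eapply filter_imp; [|apply (locally_rad_dom_t T t r om HT Hd)].
    intros s Hs. now apply Hpq.
  - eapply filter_imp; [|apply (locally_rad_dom_r T t r om Hd)].
    intros s Hs. now apply Hpq.
  - eapply filter_imp; [|apply (locally_rad_dom_om T t r om Hd)].
    intros s Hs. now apply Hpq.
Qed.

Lemma rad_derivable_agree (T : R -> Prop) p q :
  open T -> rad_agree T p q -> rad_derivable T p -> rad_derivable T q.
Proof.
  intros HT Hpq Hp t r om Hd. destruct (Hp t r om Hd) as (H1 & H2 & H3).
  repeat split.
  - eapply ex_derive_ext_loc; [|exact H1].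
    eapply filter_imp; [|apply (locally_rad_dom_t T t r om HT Hd)].
    intros s Hs. now apply Hpq.
  - eapply ex_derive_ext_loc; [|exact H2].
    eapply filter_imp; [|apply (locally_rad_dom_r T t r om Hd)].
    intros s Hs. now apply Hpq.
  - eapply ex_derive_ext_loc; [|exact H3].
    eapply filter_imp; [|apply (locally_rad_dom_om T t r om Hd)].
    intros s Hs. now apply Hpq.
Qed.

Lemma rad_derivable_add (T : R -> Prop) p q :
  rad_derivable T p -> rad_derivable T q -> rad_derivable T (rad_add p q).
Proof.
  intros Hp Hq t r om Hd. destruct (Hp t r om Hd) as (? & ? & ?).
  destruct (Hq t r om Hd) as (? & ? & ?). unfold rad_add.
  repeat split; auto_derive; auto.
Qed.

Lemma rad_derivable_mul (T : R -> Prop) p q :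
  rad_derivable T p -> rad_derivable T q ->
  rad_derivable T (fun t r om => p t r om * q t r om).
Proof.
  intros Hp Hq t r om Hd. destruct (Hp t r om Hd) as (? & ? & ?).
  destruct (Hq t r om Hd) as (? & ? & ?).
  repeat split; auto_derive; auto.
Qed.

Lemma rad_derivable_inv (T : R -> Prop) p :
  (forall t r om, rad_dom T t r om -> p t r om <> 0) ->
  rad_derivable T p -> rad_derivable T (fun t r om => / p t r om).
Proof.
  intros H0 Hp t r om Hd. destruct (Hp t r om Hd) as (? & ? & ?).
  specialize (H0 t r om Hd).
  repeat split; auto_derive; auto.
Qed.

Lemma rad_derivable_const (T : R -> Prop) (k : R) : rad_derivable T (fun _ _ _ => k).
Proof. intros t r om _. repeat apply conj; apply @ex_derive_const. Qed.

Lemma class_C_rad_derivable (T : R -> Prop) k p :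
  class_C (S k) T (lift p) -> rad_derivable T p.
Proof.
  intros (_ & Hp & _) t r om Hd.
  destruct (Hp t r 0 om) as (H1 & H2 & _ & H4).
  - split; [exact Hd | lra].
  - now repeat split.
Qed.

Lemma class_C_slice (T : R -> Prop) k f mu :
  -1 <= mu <= 1 -> class_C (S k) T f ->
  rad_derivable T (fun t r om => f t r mu om).
Proof.
  intros Hmu (_ & Hf & _) t r om Hd.
  destruct (Hf t r mu om (conj Hd Hmu)) as (H1 & H2 & _ & H4).
  now repeat apply conj.
Qed.

Lemma quad_rad_derivable (T : R -> Prop) k f p q s :
  open T -> class_C (S k) T f -> agree T f (quad p q s) ->
  rad_derivable T p /\ rad_derivable T q /\ rad_derivable T s.
Proof.
  intros HT Hf Hq.
  assert (H0 := class_C_slice T k f 0 ltac:(lra) Hf).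
  assert (H1 := class_C_slice T k f 1 ltac:(lra) Hf).
  assert (H2 := class_C_slice T k f (-1) ltac:(lra) Hf).
  assert (E : forall t r mu om, rad_dom T t r om -> -1 <= mu <= 1 ->
            f t r mu om = p t r om + mu * q t r om + mu ^ 2 * s t r om).
  { intros t r mu om Hd Hm. apply (Hq t r mu om). now split. }
  repeat apply conj.
  - eapply rad_derivable_agree; [exact HT| |exact H0].
    intros t r om Hd. cbv beta. rewrite E by (auto; lra). ring.
  (* The odd coefficient is q = (f(1) - f(-1)) / 2. *)
  - eapply (rad_derivable_agree T
      (fun t r om => / 2 * rad_add (fun t r om => f t r 1 om)
         (fun t r om => -1 * f t r (-1) om) t r om)); [exact HT| |].
    + intros t r om Hd. unfold rad_add. rewrite !E by (auto; lra). field.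
    + apply rad_derivable_mul; [apply rad_derivable_const|].
      apply rad_derivable_add; [exact H1|].
      apply rad_derivable_mul; [apply rad_derivable_const | exact H2].
  (* The quadratic coefficient is s = (f(1) + f(-1)) / 2 - f(0). *)
  - eapply (rad_derivable_agree T
      (rad_add (fun t r om => / 2 * rad_add (fun t r om => f t r 1 om)
         (fun t r om => f t r (-1) om) t r om)
         (fun t r om => -1 * f t r 0 om))); [exact HT| |].
    + intros t r om Hd. unfold rad_add. rewrite !E by (auto; lra). field.
    + apply rad_derivable_add.
      * apply rad_derivable_mul; [apply rad_derivable_const|].
        now apply rad_derivable_add.
      * apply rad_derivable_mul; [apply rad_derivable_const | exact H0].
Qed.

(** * Angular moments of polynomials and of the collision term *)

(** Odd powers integrate to zero, while mu^2 and mu^4 have means 1/3 and 1/5. Degree 4 is enough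
    because D^+ and D^- raise the degree of a quadratic by at most two. *)
Lemma mean_quartic (f : phasefun) t r om a0 a1 a2 a3 a4 :
  (forall mu, -1 < mu < 1 -> f t r mu om
     = a0 + a1 * mu + a2 * mu ^ 2 + a3 * mu ^ 3 + a4 * mu ^ 4) ->
  mean f t r om = a0 + a2 / 3 + a4 / 5.
Proof.
  intros Hf. unfold mean.
  rewrite (RInt_ext _ (fun mu =>
    a0 + a1 * mu + a2 * mu ^ 2 + a3 * mu ^ 3 + a4 * mu ^ 4)).
  2:{ intros x. rewrite Rmin_left, Rmax_right by lra. apply Hf. }
  set (F := fun x => a0 * x + a1 * x ^ 2 / 2 + a2 * x ^ 3 / 3
                     + a3 * x ^ 4 / 4 + a4 * x ^ 5 / 5).
  assert (HI : is_RInt (fun mu =>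
    a0 + a1 * mu + a2 * mu ^ 2 + a3 * mu ^ 3 + a4 * mu ^ 4) (-1) 1
    (minus (F 1) (F (-1)))).
  { apply (is_RInt_derive F).
    - intros x _. unfold F. auto_derive; [exact I|]. simpl. field.
    - intros x _. apply (ex_derive_continuous (V := R_NormedModule)).
      auto_derive; exact I. }
  rewrite (is_RInt_unique _ _ _ _ HI).
  unfold F, minus, plus, opp. simpl. field.
Qed.

Lemma mean_quad (T : R -> Prop) f p q s t r om :
  agree T f (quad p q s) -> rad_dom T t r om ->
  mean f t r om = p t r om + s t r om / 3.
Proof.
  intros Hf Hd.
  rewrite (mean_quartic f t r om (p t r om) (q t r om) (s t r om) 0 0).
  - field.
  - intros mu Hm. rewrite Hf by (split; [exact Hd | lra]). unfold quad. ring.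
Qed.

Lemma mean_mu_quad (T : R -> Prop) f p q s t r om :
  agree T f (quad p q s) -> rad_dom T t r om ->
  mean_mu f t r om = q t r om / 3.
Proof.
  intros Hf Hd.
  change (mean_mu f t r om) with (mean (fun t r mu om => f t r mu om * mu) t r om).
  rewrite (mean_quartic _ t r om 0 (p t r om) (q t r om) (s t r om) 0).
  - field.
  - intros mu Hm. rewrite Hf by (split; [exact Hd | lra]). unfold quad. ring.
Qed.

(** Scattering conserves the angular mean: the two [phi0] terms cancel and the [phi1] term is odd in
    mu. Only continuity of f is assumed, so that the lemma covers Hilbert coefficients of every
    order. *)
Lemma mean_Jop (T : R -> Prop) tchi phi0 phi1 f t r om :
  cont_on T f -> rad_dom T t r om ->
  mean (Jop tchi phi0 phi1 f) t r om = - tchi t r om * mean f t r om.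
Proof.
  intros Hf Hd.
  assert (Hex : ex_RInt (fun mu => f t r mu om) (-1) 1).
  { apply (ex_RInt_continuous (V := R_CompleteNormedModule)).
    intros mu Hm. rewrite Rmin_left, Rmax_right in Hm by lra.
    apply (continuous_comp (fun mu => (t, r, mu, om))
      (fun x : R * R * R * R =>
         f (fst (fst (fst x))) (snd (fst (fst x))) (snd (fst x)) (snd x))).
    - intros P [eps HP]. exists eps. intros y Hy. apply HP.
      repeat apply conj; try apply ball_center. exact Hy.
    - apply (Hf t r mu om). now split. }
  unfold mean at 1, Jop, Cop.
  set (M := mean f t r om). set (m := mean_mu f t r om).
  set (x := tchi t r om). set (y := phi0 t r om). set (z := phi1 t r om).
  (* The moments of f are constants in mu, so J(f) is a multiple of f plus this affine function of
     mu. *)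
  assert (Hlin : is_RInt (fun mu => y * M + 3 * z * m * mu) (-1) 1
                   (2 * (y * M))).
  { replace (2 * (y * M)) with
      (minus ((fun u => y * M * u + 3 * z * m * u ^ 2 / 2) 1)
             ((fun u => y * M * u + 3 * z * m * u ^ 2 / 2) (-1)))
      by (unfold minus, plus, opp; simpl; field).
    apply (is_RInt_derive (fun u => y * M * u + 3 * z * m * u ^ 2 / 2)).
    - intros u _. auto_derive; [exact I|]. simpl. field.
    - intros u _. apply (ex_derive_continuous (V := R_NormedModule)).
      auto_derive; exact I. }
  assert (HI := is_RInt_plus _ _ _ _ _ _
    (is_RInt_scal _ _ _ (- (x + y)) _ (RInt_correct _ _ _ Hex)) Hlin).
  match type of HI with is_RInt ?g _ _ _ => rewrite (RInt_ext _ g) end.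
  2:{ intros mu _. unfold plus, scal. simpl. unfold mult. simpl. ring. }
  rewrite (is_RInt_unique _ _ _ _ HI).
  unfold plus, scal. simpl. unfold mult. simpl.
  unfold M, mean. field.
Qed.

(** * Inversion of the collision operator *)

(** Apart from the multiple -(tchi + phi0) f, the operator adds only a function affine in mu, so a
    quadratic right-hand side forces f to be quadratic. Taking moments of this f then closes the
    system; the factor tchi + phi0 - phi1 appears because the first moment is q / 3. *)
Lemma Jop_inverse_quad (T : R -> Prop) tchi phi0 phi1 f A C B :
  (forall t r om, rad_dom T t r om -> tchi t r om + phi0 t r om <> 0) ->
  agree T (Jop tchi phi0 phi1 f) (quad A C B) ->
  exists p q s, agree T f (quad p q s) /\
    forall t r om, rad_dom T t r om ->
      (tchi t r om + phi0 t r om) * p t r om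
        = phi0 t r om * (p t r om + s t r om / 3) - A t r om /\
      (tchi t r om + phi0 t r om - phi1 t r om) * q t r om = - C t r om /\
      (tchi t r om + phi0 t r om) * s t r om = - B t r om.
Proof.
  intros Hne HJ.
  (* The witnesses solve J(f) = A + mu C + mu^2 B pointwise for f, the moments of f being kept as
     known quantities. *)
  exists (fun t r om => (phi0 t r om * mean f t r om - A t r om)
            / (tchi t r om + phi0 t r om)).
  exists (fun t r om => (3 * phi1 t r om * mean_mu f t r om - C t r om)
            / (tchi t r om + phi0 t r om)).
  exists (fun t r om => - B t r om / (tchi t r om + phi0 t r om)).
  match goal with |- ?a /\ _ => assert (Hq : a) end.
  { intros t r mu om Hd. specialize (HJ t r mu om Hd).
    specialize (Hne t r om (proj1 Hd)).
    unfold Jop, Cop, quad in HJ |- *.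
    apply (Rmult_eq_reg_l (tchi t r om + phi0 t r om)); [|exact Hne].
    field_simplify; [|exact Hne]. lra. }
  split; [exact Hq|]. intros t r om Hd.
  assert (HM := mean_quad _ _ _ _ _ t r om Hq Hd).
  assert (Hm := mean_mu_quad _ _ _ _ _ t r om Hq Hd).
  cbv beta in HM, Hm. rewrite <- HM.
  specialize (Hne t r om Hd). repeat split.
  - field. exact Hne.
  - rewrite Rmult_minus_distr_r.
    (* Here q stands for its defining fraction; trading it for 3 [mean_mu f] cancels the moment
       inside the numerator. *)
    replace (phi1 t r om * _) with (3 * phi1 t r om * mean_mu f t r om)
      by (rewrite Hm at 1; field; exact Hne).
    field. exact Hne.
  - field. exact Hne.
Qed.

(** * D^+ and D^- on quadratics in mu, and their angular means *)

(** This is the comoving derivative d/(c dt) on functions independent of mu. *)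
Definition transport (c : R) (v : bgfun) (p : radfun) : radfun :=
  fun t r om => (Derive (fun s => p s r om) t
                 + v t r * Derive (fun s => p t s om) r) / c.

Lemma pd_quad (T : R -> Prop) f p q s t r mu om :
  open T -> agree T f (quad p q s) ->
  rad_derivable T p -> rad_derivable T q -> rad_derivable T s ->
  phase_dom T t r mu om ->
  let D1 x := Derive (fun u => x u r om) t in
  let D2 x := Derive (fun u => x t u om) r in
  let D4 x := Derive (fun u => x t r u) om in
  pd_t f t r mu om = D1 p + mu * D1 q + mu ^ 2 * D1 s /\
  pd_r f t r mu om = D2 p + mu * D2 q + mu ^ 2 * D2 s /\
  pd_om f t r mu om = D4 p + mu * D4 q + mu ^ 2 * D4 s.
Proof.
  intros HT Hf Hp Hq Hs [Hd Hm] D1 D2 D4.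
  destruct (rad_agree_Derive T (fun t r om => f t r mu om)
     (fun t r om => quad p q s t r mu om) t r om HT) as (E1 & E2 & E3).
  { intros t' r' om' Hd'. apply Hf. now split. }
  { exact Hd. }
  unfold pd_t, pd_r, pd_om. rewrite E1, E2, E3. unfold quad.
  destruct (Hp t r om Hd) as (? & ? & ?), (Hq t r om Hd) as (? & ? & ?),
    (Hs t r om Hd) as (? & ? & ?).
  repeat split; apply is_derive_unique; auto_derive; auto;
    unfold D1, D2, D4; ring.
Qed.

(* At mu = -1 and mu = 1 the derivative depends on how f is extended beyond
   [-1,1]; the factor 1 - mu^2 removes this dependence. *)
Lemma pd_mu_quad (T : R -> Prop) f p q s t r mu om :
  agree T f (quad p q s) -> phase_dom T t r mu om ->
  (1 - mu ^ 2) * pd_mu f t r mu om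
  = (1 - mu ^ 2) * (q t r om + 2 * mu * s t r om).
Proof.
  intros Hf [Hd Hm].
  destruct (Req_dec mu 1) as [->|H1]; [ring|].
  destruct (Req_dec mu (-1)) as [->|H2]; [ring|].
  f_equal. unfold pd_mu.
  rewrite (Derive_ext_loc _ (fun u => quad p q s t r u om)).
  - unfold quad. apply is_derive_unique. auto_derive; [exact I|]. ring.
  - assert (Hl : locally mu (fun u => -1 < u /\ u < 1)).
    { apply filter_and; [apply (open_gt (-1)) | apply (open_lt 1)]; lra. }
    eapply filter_imp; [|exact Hl]. intros u Hu. apply Hf. split; [exact Hd|lra].
Qed.

(** Since [pd_mu] enters D^+ only with the factor 1 - mu^2, the formula also holds at mu = -1 and mu
    = 1. *)
Lemma Dplus_quad (T : R -> Prop) c rho v f p q s t r mu om :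
  open T -> agree T f (quad p q s) ->
  rad_derivable T p -> rad_derivable T q -> rad_derivable T s ->
  phase_dom T t r mu om ->
  let K := dlnrho c rho v t r + 3 * v t r / (c * r) in
  let D4 x := Derive (fun u => x t r u) om in
  Dplus c rho v f t r mu om
  = transport c v p t r om + mu * transport c v q t r om
    + mu ^ 2 * transport c v s t r om
    + mu * K * (1 - mu ^ 2) * (q t r om + 2 * mu * s t r om)
    + (mu ^ 2 * K - v t r / (c * r)) * om * (D4 p + mu * D4 q + mu ^ 2 * D4 s).
Proof.
  intros HT Hf Hp Hq Hs Hd K D4.
  destruct (pd_quad T f p q s t r mu om HT Hf Hp Hq Hs Hd) as (E1 & E2 & E4).
  assert (E3 := pd_mu_quad T f p q s t r mu om Hf Hd).
  unfold Dplus. rewrite E1, E2, E4. fold K.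
  rewrite (Rmult_assoc (mu * K) _ (pd_mu _ _ _ _ _)), E3.
  unfold transport, Rdiv. unfold D4. ring.
Qed.

Lemma Dminus_quad (T : R -> Prop) f p q s t r mu om :
  open T -> agree T f (quad p q s) ->
  rad_derivable T p -> rad_derivable T q -> rad_derivable T s ->
  phase_dom T t r mu om ->
  let D2 x := Derive (fun u => x t u om) r in
  Defs.Dminus f t r mu om
  = mu * (D2 p + mu * D2 q + mu ^ 2 * D2 s)
    + / r * (1 - mu ^ 2) * (q t r om + 2 * mu * s t r om).
Proof.
  intros HT Hf Hp Hq Hs Hd D2.
  destruct (pd_quad T f p q s t r mu om HT Hf Hp Hq Hs Hd) as (E1 & E2 & E4).
  assert (E3 := pd_mu_quad T f p q s t r mu om Hf Hd).
  unfold Defs.Dminus. rewrite E2, Rmult_assoc, E3. unfold D2. ring.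
Qed.

(* mean_Dplus_0 and mean_Dplus_2 are the angular means of D^+ (p) and of
   D^+ (mu^2 s) for p, s independent of mu. *)
Definition mean_Dplus_0 (c : R) (rho v : bgfun) (p : radfun) : radfun :=
  fun t r om => transport c v p t r om
    + / 3 * dlnrho c rho v t r * om * Derive (fun u => p t r u) om.

Definition mean_Dplus_2 (c : R) (rho v : bgfun) (s : radfun) : radfun :=
  fun t r om =>
    let K := dlnrho c rho v t r + 3 * v t r / (c * r) in
    transport c v s t r om / 3 + 4 / 15 * K * s t r om
    + (K / 5 - v t r / (c * r) / 3) * om * Derive (fun u => s t r u) om.

(** D^+ preserves parity, so q drops out. In the p part K / 3 - v / (c r) reduces to a third of
    [dlnrho]. *)
Lemma mean_Dplus_quad (T : R -> Prop) c rho v f p q s t r om :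
  open T -> 0 < c -> agree T f (quad p q s) ->
  rad_derivable T p -> rad_derivable T q -> rad_derivable T s ->
  rad_dom T t r om ->
  mean (Dplus c rho v f) t r om
  = mean_Dplus_0 c rho v p t r om + mean_Dplus_2 c rho v s t r om.
Proof.
  intros HT Hc Hf Hp Hq Hs Hd.
  set (K := dlnrho c rho v t r + 3 * v t r / (c * r)).
  set (w := v t r / (c * r)).
  set (D4 := fun x : radfun => Derive (fun u => x t r u) om).
  rewrite (mean_quartic _ t r om
    (transport c v p t r om - w * om * D4 p)
    (transport c v q t r om + K * q t r om - w * om * D4 q)
    (transport c v s t r om + 2 * K * s t r om + K * om * D4 p - w * om * D4 s)
    (- K * q t r om + K * om * D4 q)
    (- 2 * K * s t r om + K * om * D4 s)).
  - unfold mean_Dplus_0, mean_Dplus_2. unfold D4, w, K.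
    destruct Hd as (_ & Hr & _). field. lra.
  - intros mu Hm.
    assert (Hdm : phase_dom T t r mu om) by (split; [exact Hd|lra]).
    rewrite (Dplus_quad T c rho v f p q s t r mu om HT Hf Hp Hq Hs Hdm).
    fold K w. unfold D4. ring.
Qed.

(** D^- reverses parity, so it contributes only through q. Its two terms together are the spherical
    divergence of q / 3, that is, r^(-2) times the r-derivative of r^2 q / 3. *)
Lemma mean_Dop_quad (T : R -> Prop) c rho v f p q s t r om :
  open T -> 0 < c -> agree T f (quad p q s) ->
  rad_derivable T p -> rad_derivable T q -> rad_derivable T s ->
  rad_dom T t r om ->
  mean (Dop c rho v f) t r om
  = mean_Dplus_0 c rho v p t r om + mean_Dplus_2 c rho v s t r om
    + Derive (fun u => q t u om) r / 3 + 2 / (3 * r) * q t r om.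
Proof.
  intros HT Hc Hf Hp Hq Hs Hd.
  set (K := dlnrho c rho v t r + 3 * v t r / (c * r)).
  set (w := v t r / (c * r)).
  set (D2 := fun x : radfun => Derive (fun u => x t u om) r).
  set (D4 := fun x : radfun => Derive (fun u => x t r u) om).
  rewrite (mean_quartic _ t r om
    (transport c v p t r om - w * om * D4 p + / r * q t r om)
    (transport c v q t r om + K * q t r om - w * om * D4 q
     + D2 p + / r * 2 * s t r om)
    (transport c v s t r om + 2 * K * s t r om + K * om * D4 p - w * om * D4 s
     + D2 q - / r * q t r om)
    (- K * q t r om + K * om * D4 q + D2 s - / r * 2 * s t r om)
    (- 2 * K * s t r om + K * om * D4 s)).
  - unfold mean_Dplus_0, mean_Dplus_2. unfold D2, D4, w, K.
    destruct Hd as (_ & Hr & _). field. lra.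
  - intros mu Hm. unfold Dop.
    assert (Hdm : phase_dom T t r mu om) by (split; [exact Hd|lra]).
    rewrite (Dplus_quad T c rho v f p q s t r mu om HT Hf Hp Hq Hs Hdm).
    rewrite (Dminus_quad T f p q s t r mu om HT Hf Hp Hq Hs Hdm).
    fold K w. unfold D2, D4. ring.
Qed.

(** * Calculation rules for the means and for the formal series *)

Lemma mean_Dplus_0_agree (T : R -> Prop) c rho v p q t r om :
  open T -> rad_agree T p q -> rad_dom T t r om ->
  mean_Dplus_0 c rho v p t r om = mean_Dplus_0 c rho v q t r om.
Proof.
  intros HT Hpq Hd. unfold mean_Dplus_0, transport.
  destruct (rad_agree_Derive T p q t r om HT Hpq Hd) as (-> & -> & ->).
  reflexivity.
Qed.

Lemma mean_Dplus_0_add (T : R -> Prop) c rho v p q t r om :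
  0 < c -> rad_derivable T p -> rad_derivable T q -> rad_dom T t r om ->
  mean_Dplus_0 c rho v (rad_add p q) t r om
  = mean_Dplus_0 c rho v p t r om + mean_Dplus_0 c rho v q t r om.
Proof.
  intros Hc Hp Hq Hd.
  destruct (Hp t r om Hd) as (? & ? & ?), (Hq t r om Hd) as (? & ? & ?).
  unfold mean_Dplus_0, transport, rad_add.
  rewrite !Derive_plus by auto.
  change (fun u => p t r u) with (p t r). change (fun u => q t r u) with (q t r).
  unfold Rdiv. ring.
Qed.

Lemma mean_Dplus_2_0 c rho v t r om :
  mean_Dplus_2 c rho v rad0 t r om = 0.
Proof.
  unfold mean_Dplus_2, transport, rad0.
  rewrite !Derive_const. unfold Rdiv. ring.
Qed.

Lemma mean_zero t r om : mean (fun _ _ _ _ => 0) t r om = 0.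
Proof.
  unfold mean. rewrite RInt_const.
  unfold scal. simpl. unfold mult. simpl. ring.
Qed.

Lemma Dop_zero c rho v : forall t r mu om,
  Dop c rho v (fun _ _ _ _ => 0) t r mu om = 0.
Proof.
  intros. unfold Dop, Dplus, Defs.Dminus, pd_t, pd_r, pd_mu, pd_om.
  rewrite !Derive_const. unfold Rdiv. ring.
Qed.

Lemma mean_Dop_zero c rho v t r om :
  mean (Dop c rho v (fun _ _ _ _ => 0)) t r om = 0.
Proof.
  rewrite (mean_quartic _ t r om 0 0 0 0 0); [field|].
  intros. rewrite Dop_zero. ring.
Qed.

Lemma expansion_neg f n : (n < 0)%Z -> expansion f n = fun _ _ _ _ => 0.
Proof. intros Hn. unfold expansion. apply Z.ltb_lt in Hn. now rewrite Hn. Qed.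

Lemma expansion_nonneg f n : (0 <= n)%Z -> expansion f n = f (Z.to_nat n).
Proof. intros Hn. unfold expansion. apply Z.ltb_ge in Hn. now rewrite Hn. Qed.

(** Because lambda carries one factor eps, the diffusion term at order n involves beta at order n -
    1. *)
Lemma diffusion_lhs_unfold c rho v lamb beta n t r om :
  diffusion_lhs c rho v lamb beta n t r om
  = mean_Dplus_0 c rho v (beta n) t r om
    - / r ^ 2 * Derive (fun s => s ^ 2 * (lamb t s om
        * Derive (fun x => beta (n - 1)%Z t x om) s / 3)) r.
Proof. reflexivity. Qed.

Lemma Derive_diffusion_zero (l : R -> R) (r : R) (b : R -> R) :
  (forall s, b s = 0) ->
  Derive (fun s => s ^ 2 * (l s * Derive b s / 3)) r = 0.
Proof.
  intros Hb. rewrite (Derive_ext _ (fun _ => 0)).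
  - apply Derive_const.
  - intros s. rewrite (Derive_ext b (fun _ => 0)) by exact Hb.
    rewrite Derive_const. unfold Rdiv. ring.
Qed.

(** * Comparison of coefficients in powers of eps *)

Theorem theorem2p15 :
  forall (T : R -> Prop) (c : R) (rho v : bgfun)
         (jb chib phi0b phi1b : radfun) (f : nat -> phasefun),
  let tchib := rad_add jb chib in
  let beta := mean_series (expansion f) in
  let mean_Df := mean_series (Dop_series c rho v (expansion f)) in
  open T ->
  0 < c ->
  (forall t r, T t -> 0 < r -> 0 < rho t r) ->
  (forall t r om, rad_dom T t r om -> 0 <= jb t r om) ->
  (forall t r om, rad_dom T t r om -> 0 <= chib t r om) ->
  (forall t r om, rad_dom T t r om -> tchib t r om <> 0) ->
  (forall t r om, rad_dom T t r om -> tchib t r om + phi0b t r om <> 0) ->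
  (forall t r om, rad_dom T t r om ->
     tchib t r om + phi0b t r om - phi1b t r om <> 0) ->
  class_C 2 T (lift_bg rho) ->
  class_C 2 T (lift_bg v) ->
  class_C 2 T (lift jb) ->
  class_C 2 T (lift chib) ->
  class_C 2 T (lift phi0b) ->
  class_C 2 T (lift phi1b) ->
  (forall i, class_C 1 T (f i)) ->
  hilbert_hierarchy T c rho v jb tchib phi0b phi1b f ->
  series_eq T mean_Df (reaction_rhs jb tchib beta) /\
  exists N : rad_series,
    DplusDplus_terms T c rho v tchib phi0b (f O) N /\
    series_eq_upto T 2 mean_Df
      (series_add
         (diffusion_lhs c rho v (lambda tchib phi0b phi1b) beta) N).
Proof.
  intros T c rho v jb chib phi0b phi1b f tchib beta mean_Df
    HT Hc _ _ _ Ht Ht0 Ht01 _ _ Hj Hchi Hphi0 _ Hf [HH0 HH].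
  assert (dt : rad_derivable T tchib).
  { apply rad_derivable_add; now apply (class_C_rad_derivable T 1). }
  assert (d0 : rad_derivable T phi0b) by now apply (class_C_rad_derivable T 1).
  clearbody tchib.
  assert (HJ0 : agree T (Jop tchib phi0b phi1b (f O))
                  (quad (fun t r om => - jb t r om) rad0 rad0)).
  { intros t r mu om Hd. specialize (HH0 t r mu om Hd).
    unfold quad, rad0. lra. }
  split.
  (* The angular mean of the Boltzmann equation: both sides vanish below order -1, order -1 is the
     mean of 0 = j + J(f_0), and order n >= 0 is the mean of D(f_n) = J(f_(n+1)). *)
  - intros n t r om Hd.
    unfold mean_Df, reaction_rhs, series_sub, mono_mul, beta, monomial,
      mean_series, Dop_series.
    destruct (Z_lt_le_dec n 0) as [Hn|Hn].
    + rewrite (expansion_neg f n Hn), mean_Dop_zero.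
      destruct (Z.eqb_spec n (-1)) as [->|Hn1].
      * rewrite expansion_nonneg by lia. simpl (Z.to_nat _).
        assert (E := mean_Jop T tchib phi0b phi1b (f O) t r om
                       (proj1 (Hf O)) Hd).
        rewrite (mean_quad _ _ _ _ _ _ _ _ HJ0 Hd) in E.
        unfold rad0 in E. lra.
      * rewrite expansion_neg by lia. rewrite mean_zero. ring.
    + destruct (Z.eqb_spec n (-1)) as [->|_]; [lia|].
      rewrite !expansion_nonneg by lia.
      replace (Z.to_nat (n - -1)) with (S (Z.to_nat n)) by lia.
      set (i := Z.to_nat n).
      transitivity (mean (Jop tchib phi0b phi1b (f (S i))) t r om).
      * unfold mean. f_equal. apply RInt_ext. intros mu Hm.
        rewrite Rmin_left, Rmax_right in Hm by lra.
        apply HH. split; [exact Hd | lra].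
      * rewrite (mean_Jop T) by (exact Hd || exact (proj1 (Hf (S i)))). ring.
  - destruct (Jop_inverse_quad T tchib phi0b phi1b (f O) _ _ _ Ht0 HJ0)
      as (p0 & q0 & s0 & Hq0 & Heq0).
    assert (Hf0 : agree T (f O) (quad p0 rad0 rad0)).
    { intros t r mu om Hd. rewrite (Hq0 t r mu om Hd).
      destruct Hd as [Hd _]. destruct (Heq0 t r om Hd) as (_ & E2 & E3).
      unfold rad0 in E2, E3. rewrite Ropp_0 in E2, E3.
      apply Rmult_integral in E2. apply Rmult_integral in E3.
      destruct E2 as [E2|E2]; [now elim (Ht01 t r om Hd)|].
      destruct E3 as [E3|E3]; [now elim (Ht0 t r om Hd)|].
      unfold quad, rad0. rewrite E2, E3. reflexivity. }
    clear q0 s0 Hq0 Heq0.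
    destruct (quad_rad_derivable T 0 (f O) p0 rad0 rad0 HT (Hf O) Hf0)
      as (Hp0 & H00 & _).
    set (D2p0 := fun t r om => Derive (fun u => p0 t u om) r).
    (* D(f_0) = A + mu [D2p0] + mu^2 B, where A and B come from D^+ and the middle coefficient from
       D^-. *)
    set (A := fun t r om => transport c v p0 t r om
                - v t r / (c * r) * om * Derive (fun u => p0 t r u) om).
    set (B := fun t r om => (dlnrho c rho v t r + 3 * v t r / (c * r))
                * om * Derive (fun u => p0 t r u) om).
    assert (HD0 : agree T (Dplus c rho v (f O)) (quad A rad0 B)).
    { intros t r mu om Hd.
      rewrite (Dplus_quad T c rho v (f O) p0 rad0 rad0) by assumption.
      unfold quad, A, B, transport, rad0. rewrite !Derive_const.
      unfold Rdiv. ring. }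
    assert (HJ1 : agree T (Jop tchib phi0b phi1b (f 1%nat)) (quad A D2p0 B)).
    { intros t r mu om Hd. rewrite <- HH by exact Hd.
      unfold Dop. rewrite (HD0 t r mu om Hd).
      rewrite (Dminus_quad T (f O) p0 rad0 rad0) by assumption.
      unfold quad, D2p0, rad0. rewrite !Derive_const. ring. }
    destruct (Jop_inverse_quad T tchib phi0b phi1b (f 1%nat) _ _ _ Ht0 HJ1)
      as (P & Q & S & Hf1 & Heq).
    destruct (quad_rad_derivable T 0 (f 1%nat) P Q S HT (Hf 1%nat) Hf1)
      as (HP & HQ & HS).
    set (M := rad_add P (fun t r om => / 3 * S t r om)).
    assert (HM : rad_derivable T M).
    { apply rad_derivable_add; [exact HP|].
      apply rad_derivable_mul; [apply rad_derivable_const | exact HS]. }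
    set (a := fun t r om => / rad_add tchib phi0b t r om).
    assert (Ha : rad_derivable T a).
    { apply rad_derivable_inv; [exact Ht0 | now apply rad_derivable_add]. }
    (* Y = mean (D^+ f_0) / (tchi + phi0) and X = - D^+ (f_0) / (tchi + phi0)
       at mu = 0 *)
    set (Y := fun t r om => -1 * (a t r om * (tchib t r om * M t r om))).
    (* Expressing Y through the mean M of f_1, by mean (D^+ f_0) = - tchi M, gives its
       differentiability without second derivatives of f_0. *)
    assert (HY : rad_derivable T Y).
    { apply rad_derivable_mul; [apply rad_derivable_const|].
      apply rad_derivable_mul; [exact Ha|].
      now apply rad_derivable_mul. }
    set (X := rad_add P (fun t r om => -1 * rad_add M Y t r om)).
    assert (HX : rad_derivable T X).
    { apply rad_derivable_add; [exact HP|].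
      apply rad_derivable_mul; [apply rad_derivable_const|].
      now apply rad_derivable_add. }
    assert (Hab : coeff_built T tchib phi0b 1 a).
    { apply (built_inv T tchib phi0b (-1)); [|exact Ht0].
      apply built_add; constructor. }
    (* The constant term is X = P - M - Y because phi0 / (tchi + phi0) = 1 - tchi / (tchi +
       phi0). *)
    assert (HX1 : agree T
      (fun t r mu om => - a t r om * Dplus c rho v (f O) t r mu om)
      (quad X rad0 S)).
    { intros t r mu om Hd. rewrite (HD0 t r mu om Hd).
      destruct Hd as [Hd _]. destruct (Heq t r om Hd) as (E1 & _ & E3).
      specialize (Ht0 t r om Hd).
      unfold quad, X, Y, M, a, rad_add, rad0 in *.
      replace (A t r om) with (phi0b t r om * (P t r om + S t r om / 3)
        - (tchib t r om + phi0b t r om) * P t r om) by lra.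
      replace (B t r om) with
        (- ((tchib t r om + phi0b t r om) * S t r om)) by lra.
      field. exact Ht0. }
    assert (HY1 : agree T
      (fun t r mu om => a t r om
         * lift (mean (Dplus c rho v (f O))) t r mu om)
      (quad Y rad0 rad0)).
    { intros t r mu om [Hd _]. unfold lift.
      rewrite (mean_quad _ _ _ _ _ _ _ _ HD0 Hd).
      destruct (Heq t r om Hd) as (E1 & _ & E3).
      specialize (Ht0 t r om Hd).
      unfold quad, Y, M, a, rad_add, rad0 in *.
      replace (A t r om) with (phi0b t r om * (P t r om + S t r om / 3)
        - (tchib t r om + phi0b t r om) * P t r om) by lra.
      replace (B t r om) with
        (- ((tchib t r om + phi0b t r om) * S t r om)) by lra.
      field. exact Ht0. }
    (* Subtracting the mean of f_1 turns the coefficient - phi0 / (tchi (tchi + phi0)) of mean (D^+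
       f_0) into 1 / (tchi + phi0). Both terms have order 1; at order 0 no remainder arises, as f_0
       is isotropic. *)
    exists (series_add
        (monomial 1 (mean_Dplus_mul c rho v (fun t r om => - a t r om)
           (Dplus c rho v (f O))))
        (series_add
          (monomial 1 (mean_Dplus_mul c rho v a
             (lift (mean (Dplus c rho v (f O)))))) series0)).
    split.
    { apply DD_direct; [now apply built_opp|].
      apply DD_mean; [exact Hab | apply DD_nil]. }
    intros n t r om Hn Hd.
    unfold mean_Df, series_add, monomial, series0, mean_series, Dop_series.
    rewrite diffusion_lhs_unfold. unfold beta, mean_series.
    destruct (Z_lt_le_dec n 1) as [Hn1|Hn1].
    + rewrite (proj2 (Z.eqb_neq n 1)) by lia.
      (* For n <= 0 the diffusion term contains beta at a negative order, which is zero. *)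
      rewrite Derive_diffusion_zero.
      2:{ intros s. rewrite expansion_neg by lia. apply mean_zero. }
      destruct (Z_lt_le_dec n 0) as [Hn0|Hn0].
      * rewrite (expansion_neg f n Hn0), mean_Dop_zero.
        rewrite (mean_Dplus_0_agree T c rho v _ rad0)
          by (assumption || intros ? ? ? _; apply mean_zero).
        unfold mean_Dplus_0, transport, rad0. rewrite !Derive_const.
        unfold Rdiv. ring.
      * replace n with 0%Z by lia. simpl (expansion f 0%Z).
        rewrite (mean_Dop_quad T c rho v (f O) p0 rad0 rad0) by assumption.
        rewrite mean_Dplus_2_0.
        rewrite (mean_Dplus_0_agree T c rho v (mean (f O)) p0) by
         (assumption || (intros t' r' om' Hd';
          rewrite (mean_quad _ _ _ _ _ _ _ _ Hf0 Hd'); unfold rad0; field)).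
        unfold rad0. rewrite Derive_const. unfold Rdiv. ring.
    + replace n with 1%Z by lia. simpl (expansion f _). simpl (Z.eqb 1 1).
      cbv iota.
      unfold mean_Dplus_mul.
      rewrite (mean_Dplus_quad T c rho v _ X rad0 S) by assumption.
      rewrite (mean_Dplus_quad T c rho v _ Y rad0 rad0) by assumption.
      rewrite (mean_Dop_quad T c rho v (f 1%nat) P Q S) by assumption.
      rewrite mean_Dplus_2_0.
      rewrite (mean_Dplus_0_agree T c rho v (mean (f 1%nat)) M) by
       (assumption || (intros t' r' om' Hd';
        rewrite (mean_quad _ _ _ _ _ _ _ _ Hf1 Hd'); unfold M, rad_add; field)).
      (* In P = M + X + Y, M yields the reaction-type terms of the diffusion equation, while X (with
         S) and Y yield the two terms of N. *)
      rewrite (mean_Dplus_0_agree T c rho v P (rad_add M (rad_add X Y))) by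
       (assumption || (intros ? ? ? _; unfold X, rad_add; ring)).
      rewrite !(mean_Dplus_0_add T) by (assumption || now apply rad_derivable_add).
      destruct (HQ t r om Hd) as (_ & HQr & _).
      (* Near r, lambda d_r f_0 equals - Q, and Q is differentiable because f_1 is C^1; no second
         derivative of f_0 has to be assumed. *)
      assert (E : Derive (fun s => s ^ 2 * (lambda tchib phi0b phi1b t s om
          * Derive (fun x => mean (f O) t x om) s / 3)) r
        = - / 3 * (2 * r * Q t r om + r ^ 2 * Derive (fun u => Q t u om) r)).
      { rewrite (Derive_ext_loc _ (fun s => - / 3 * (s ^ 2 * Q t s om))).
        - apply is_derive_unique. auto_derive; [exact HQr|]. ring.
        - eapply filter_imp; [|apply (locally_rad_dom_r T t r om Hd)].
          intros s Hs. cbv beta.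
          rewrite (Derive_ext_loc _ (fun u : R => p0 t u om)).
          2:{ eapply filter_imp; [|apply (locally_rad_dom_r T t s om Hs)].
              intros u Hu. rewrite (mean_quad _ _ _ _ _ _ _ _ Hf0 Hu).
              unfold rad0. field. }
          destruct (Heq t s om Hs) as (_ & E2 & _).
          change (Derive (fun u => p0 t u om) s) with (D2p0 t s om).
          replace (D2p0 t s om) with
            (- ((tchib t s om + phi0b t s om - phi1b t s om) * Q t s om)) by lra.
          unfold lambda. field. now apply Ht01. }
      change (expansion f 0%Z) with (f O).
      rewrite E. destruct Hd as (_ & Hr & _). field. lra.
Qed.
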